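(* Let $0\le\delta<1$, $0<C<1$ and $0<B\le\frac1C$. For each (sufficiently large) $n$ let $X=X^{(n)}=(X_{ij})$ be uniformly distributed on the set $\mathscr{M}^{\{0,1\}}_{n,\delta}(B,C)$ of binary contingency tables, all these random matrices being defined on a common probability space, and let $$S^{\mathbf{BR}}_{n,\delta}(B,C):=\sum_{k=1}^{n}X_{n+1,k+[n^\delta]}.$$ Then, as $n\to\infty$, $$\frac1n S^{\mathbf{BR}}_{n,\delta}(B,C)\to C\qquad\text{almost surely.}$$
   Context: $[x]$ denotes the integer part of $x$. For integer vectors $\mathbf r=(r_1,\dots,r_m)$, $\mathbf c=(c_1,\dots,c_l)$ with $\sum_i r_i=\sum_j c_j$, $\mathscr{M}^{\{0,1\}}(\mathbf r,\mathbf c)$ is the set of $m\times l$ matrices with entries in $\{0,1\}$ whose $i$th row sum is $r_i$ and $j$th column sum is $c_j$ for all $i,j$. For $B,C>0$, $0\le\delta\le1$ and $n\ge1$, $\mathscr{M}^{\{0,1\}}_{n,\delta}(B,C):=\mathscr{M}^{\{0,1\}}(\widetilde{\mathbf r},\widetilde{\mathbf c})$, where $\widetilde{\mathbf r}=\widetilde{\mathbf c}\in\mathbb N^{[n^\delta]+n}$ is the vector whose first $[n^\delta]$ entries equal $[BCn]$ and whose remaining $n$ entries equal $[Cn]$. *)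

(* Defs.v *)
From HB Require Import structures.
From mathcomp Require Import all_boot all_order all_algebra.
From mathcomp Require Import all_classical all_reals all_analysis.
Set Implicit Arguments.
Unset Strict Implicit.
Unset Printing Implicit Defensive.
Import Order.TTheory GRing.Theory Num.Theory.
Import numFieldNormedType.Exports.
Local Open Scope classical_set_scope.
Local Open Scope ring_scope.

(* The entries 0 and 1 are [false] and [true], counted through the coercion
   from bool to nat. *)
Definition binary_tables (m l : nat) (r : 'rV[nat]_m) (c : 'rV[nat]_l) :
    {set 'M[bool]_(m, l)} :=
  [set A : 'M[bool]_(m, l) |
    [forall i, (\sum_(j < l) A i j)%N == r 0 i] &&
    [forall j, (\sum_(i < m) A i j)%N == c 0 j]].

(* [Num.truncn] is the integer part, as a natural number, of a nonnegative
   number; [`^] is the power with real exponent. *)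
Definition num_big (R : realType) (delta : R) (n : nat) : nat :=
  Num.truncn (n%:R `^ delta).

Definition margin (R : realType) (delta B C : R) (n : nat) :
    'rV[nat]_(num_big delta n + n) :=
  \row_i if (i < num_big delta n)%N
         then Num.truncn (B * C * n%:R) else Num.truncn (C * n%:R).

Definition bc_tables (R : realType) (delta B C : R) (n : nat) :
    {set 'M[bool]_(num_big delta n + n)} :=
  binary_tables (margin delta B C n) (margin delta B C n).

(* No law satisfies this when [M] is empty: take [A := setT]. *)
Definition uniform_on (R : realType) (d : measure_display)
    (T : measurableType d) (P : probability T R) (F : finType)
    (X : T -> F) (M : {set F}) : Prop :=
  forall A : {set F},
    measurable (X @^-1` [set` A]) /\
    P (X @^-1` [set` A]) = (#|A :&: M|%:R / #|M|%:R)%:E.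

(* Ordinals start at 0, so the outer sum selects the row of number n + 1,
   which exists as soon as 0 < n, and [rshift] the columns of number
   [n ^ delta] + 1, ..., [n ^ delta] + n. *)
Definition S_BR (R : realType) (delta : R) (n : nat)
    (A : 'M[bool]_(num_big delta n + n)) : nat :=
  (\sum_(i < num_big delta n + n | i == n :> nat)
     \sum_(k < n) A i (rshift (num_big delta n) k))%N.

(* Main.v *)
Require Import Defs.
From HB Require Import structures.
From mathcomp Require Import all_boot all_order all_algebra.
From mathcomp Require Import all_classical all_reals all_analysis.
Set Implicit Arguments.
Unset Strict Implicit.
Unset Printing Implicit Defensive.
Import Order.TTheory GRing.Theory Num.Theory.
Import numFieldNormedType.Exports.
Local Open Scope classical_set_scope.
Local Open Scope ring_scope.

(** The limit holds for every sequence of tables, by counting; probability only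
    enters to place X n in its support. Row n + 1 of a table belongs to the
    small margins, so its sum is [Cn]. Of the columns it meets, S_BR leaves out
    the first [n^delta], and a 0/1 row carries at most [n^delta] there
    ([S_BR_bounds]). Hence S_BR / n lies between ([Cn] - [n^delta]) / n and
    [Cn] / n, and both tend to C because delta < 1 ([truncn_ratio_cvg],
    [num_big_ratio_cvg0]). For each large n the table X n is almost surely in
    the support of its law ([uniform_on_ae_mem]), and countably many null
    events have a null union, so almost surely all these bounds hold at once. *)

(** The complement of [M] is itself one of the events whose probability the
    uniform law prescribes, namely 0. *)
Lemma uniform_on_ae_mem (R : realType) (d : measure_display)
    (T : measurableType d) (P : probability T R) (F : finType)
    (X : T -> F) (M : {set F}) :
  uniform_on P X M -> {ae P, forall w, X w \in M}.
Proof.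
move=> /(_ (~: M)%SET)[mX PX]; exists (X @^-1` [set` (~: M)%SET]); split => //.
- by rewrite [LHS]PX finset.setIC finset.setICr cards0 mul0r.
- by move=> w /= /negP; rewrite inE.
Qed.

(** This places row [n] (counted from 0) after the block of big margins. *)
Lemma num_big_le (R : realType) (delta : R) (n : nat) :
  delta <= 1 -> (0 < n)%N -> (num_big delta n <= n)%N.
Proof.
move=> hdelta n0; rewrite -(ler_nat R) (le_trans (y := n%:R `^ delta)) //.
  by rewrite truncn_le powR_ge0.
by rewrite ler1_powR // ler1n.
Qed.

(** The middle term is the sum of row [n]; what it has besides [S_BR A] is the
    sum of [num_big delta n] entries, each at most 1. *)
Lemma S_BR_bounds (R : realType) (delta B C : R) (n : nat)
    (A : 'M[bool]_(num_big delta n + n)) :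
  0 <= delta <= 1 -> (0 < n)%N -> A \in bc_tables delta B C n ->
  (S_BR A <= Num.truncn (C * n%:R) <= num_big delta n + S_BR A)%N.
Proof.
move=> /andP[hdelta0 hdelta1] n0; rewrite inE => /andP[/forallP rowsA _].
(* Row [n] exists because [0 <= delta] makes [n ^ delta] at least 1. *)
have nlt : (n < num_big delta n + n)%N.
  rewrite -[ltnLHS]add0n ltn_add2r truncn_gt0.
  by rewrite -[leLHS](powRr0 n%:R); apply: ler_powR; rewrite ?ler1n.
have := rowsA (Ordinal nlt).
rewrite mxE /= ltnNge num_big_le //= big_split_ord /=.
rewrite /S_BR (big_pred1 (Ordinal nlt)) => [/eqP<-|i]; last by [].
rewrite leq_addl leq_add2r /=.
rewrite -[leqRHS]card_ord -sum1_card leq_sum // => j _.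
exact: leq_b1.
Qed.

Lemma truncn_ratio_cvg (R : realType) (C : R) : 0 <= C ->
  (fun n : nat => (Num.truncn (C * n%:R))%:R / n%:R : R) @ \oo --> C.
Proof.
move=> C0; rewrite -cvg_shiftS /=.
apply: (@squeeze_cvgr _ _ _ _ (fun n => C - harmonic n) (cst C)).
- near=> n; rewrite /= ler_pdivlMr ?ltr0n // ler_pdivrMr ?ltr0n //.
  rewrite truncn_le mulr_ge0 // andbT mulrBl mulVf ?pnatr_eq0 //.
  by rewrite lerBlDr natr1 ltW // truncnS_gt.
- rewrite -[X in _ --> X]subr0.
  by apply: cvgB; [exact: cvg_cst|exact: cvg_harmonic].
- exact: cvg_cst.
Unshelve. all: by end_near. Qed.

Lemma num_big_ratio_cvg0 (R : realType) (delta : R) : delta < 1 ->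
  (fun n : nat => (num_big delta n)%:R / n%:R : R) @ \oo --> (0 : R).
Proof.
move=> hdelta; rewrite -cvg_shiftS /=.
apply: (@squeeze_cvgr _ _ _ _ (cst 0) (fun n => harmonic n `^ (1 - delta))).
- near=> n; rewrite divr_ge0 //=.
  (* With m = n + 1, the bound m ^ delta / m is written (1 / m) ^ (1 - delta):
     a power function evaluated along a sequence decreasing to 0. *)
  have powV : (harmonic n `^ delta)^-1 = n.+1%:R `^ delta :> R.
    rewrite /harmonic /= -[_.+1%:R^-1]powR_inv1 // -powRrM.
    by rewrite mulN1r powRN invrK.
  rewrite powRB ?invr_eq0 ?pnatr_eq0 ?implybT // powRr1 // powV mulrC.
  by rewrite ler_wpM2l // truncn_le powR_ge0.
- exact: cvg_cst.
- have /cvg_at_rightP : a `^ (1 - delta) @[a --> (0 : R)^'+] --> (0 : R).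
    by apply: powR_cvg0; rewrite subr_gt0.
  by apply; split => [n|]; [exact: harmonic_gt0|exact: cvg_harmonic].
Unshelve. all: by end_near. Qed.

Theorem theorem1p6 (R : realType) (delta B C : R)
    (hdelta0 : 0 <= delta) (hdelta1 : delta < 1)
    (hC0 : 0 < C) (hC1 : C < 1) (hB0 : 0 < B) (hB1 : B <= 1 / C)
    (d : measure_display) (T : measurableType d) (P : probability T R)
    (X : forall n : nat, T -> 'M[bool]_(num_big delta n + n))
    (hX : \forall n \near \oo, uniform_on P (X n) (bc_tables delta B C n)) :
  {ae P, forall w : T,
    (fun n : nat => (S_BR (X n w))%:R / n%:R : R) @ \oo --> C}.
Proof.
case: hX => N _ hX.
have hdelta : 0 <= delta <= 1 by rewrite hdelta0 ltW.
have : {ae P, forall w, forall n, (N <= n)%N ->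
    X n w \in bc_tables delta B C n}.
  apply/ae_foralln => n; have [Nn|_] := leqP N n; last exact: aeW.
  by apply: filterS (uniform_on_ae_mem (hX n Nn)) => w + _.
apply: filterS => w Xw.
apply: (@squeeze_cvgr _ _ _ _
  (fun n => (Num.truncn (C * n%:R))%:R / n%:R - (num_big delta n)%:R / n%:R)
  (fun n => (Num.truncn (C * n%:R))%:R / n%:R)).
- near=> n.
  have n0 : (0 < n)%N by near: n; exact: nbhs_infty_gt.
  have Nn : (N <= n)%N by near: n; exact: nbhs_infty_ge.
  have /andP[lo hi] := S_BR_bounds hdelta n0 (Xw n Nn).
  rewrite -mulrBl !ler_pM2r ?invr_gt0 ?ltr0n //.
  by rewrite lerBlDl -natrD !ler_nat hi lo.
- rewrite -[X in _ --> X]subr0; apply: cvgB.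
    exact: truncn_ratio_cvg (ltW hC0).
  exact: num_big_ratio_cvg0.
- exact: truncn_ratio_cvg (ltW hC0).
Unshelve. all: by end_near. Qed.
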